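(* Let $\tau > 0$, let $a_0, a_1, \alpha_0, \alpha_1 \in \mathbb{R}$, and consider the function $\Delta : \mathbb{C} \to \mathbb{C}$ given by $$\Delta(s) = s^2 + a_1 s + a_0 + e^{-s\tau} (\alpha_1 s + \alpha_0) .$$ Let $s_0 \in \mathbb{R}$. (a) The number $s_0$ is a root of multiplicity $4$ of $\Delta$ if and only if the coefficients $a_0, a_1, \alpha_0, \alpha_1$, the root $s_0$ and the delay $\tau$ satisfy the relations $$a_1 = -\frac{4}{\tau} - 2 s_0, \qquad a_0 = \frac{6}{\tau^2} + \frac{4}{\tau} s_0 + s_0^2,$$ $$\alpha_1 = -\frac{2}{\tau} e^{s_0 \tau}, \qquad \alpha_0 = \frac{2}{\tau} e^{s_0 \tau} \left(s_0 - \frac{3}{\tau}\right).$$ (b) If these four relations are satisfied, then $s_0$ is a strictly dominant root of $\Delta$.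
   Context: A root $s_0 \in \mathbb{C}$ of a function $Q : \mathbb{C} \to \mathbb{C}$ is called strictly dominant if every $s \in \mathbb{C} \setminus \{s_0\}$ with $Q(s) = 0$ satisfies $\operatorname{Re} s < \operatorname{Re} s_0$. Multiplicity of a root means its order of vanishing as a zero of the entire function $\Delta$. *)

(* Defs.v *)
From Stdlib Require Import Reals.
From Coquelicot Require Import Coquelicot.

Open Scope R_scope.

Definition Cexp (z : C) : C :=
  (exp (Re z) * cos (Im z), exp (Re z) * sin (Im z)).

Definition entire (f : C -> C) : Prop :=
  forall z : C, @ex_derive C_AbsRing C_NormedModule f z.

Definition C_derive_n (f : C -> C) (n : nat) : C -> C :=
  Nat.iter n C_derive f.

(* [C_derive] is a total operator; it is the complex derivative wherever the
   latter exists.  As the derivative of an entire function is entire, the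
   first conjunct makes every iterated derivative below a genuine one. *)
Definition root_of_multiplicity (f : C -> C) (z0 : C) (n : nat) : Prop :=
  entire f /\
  (forall k : nat, (k < n)%nat -> C_derive_n f k z0 = RtoC 0) /\
  C_derive_n f n z0 <> RtoC 0.

Definition strictly_dominant_root (Q : C -> C) (z0 : C) : Prop :=
  Q z0 = RtoC 0 /\
  forall s : C, s <> z0 -> Q s = RtoC 0 -> Re s < Re z0.

Definition quasipolynomial (tau a0 a1 alpha0 alpha1 : R) (s : C) : C :=
  (s ^ 2 + a1 * s + a0 + Cexp (- s * tau) * (alpha1 * s + alpha0))%C.

Definition quadruple_root_relations
  (tau a0 a1 alpha0 alpha1 s0 : R) : Prop :=
  a1 = - (4 / tau) - 2 * s0 /\
  a0 = 6 / tau ^ 2 + 4 / tau * s0 + s0 ^ 2 /\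
  alpha1 = - (2 / tau) * exp (s0 * tau) /\
  alpha0 = 2 / tau * exp (s0 * tau) * (s0 - 3 / tau).

(* Main.v *)
Require Import Defs.
From Stdlib Require Import Reals Lra Lia FunctionalExtensionality.
From Coquelicot Require Import Coquelicot.

Open Scope R_scope.

(** Part (a) is linear algebra.  The derivatives of Delta stay in the family
    p2 s^2 + p1 s + p0 + e^(-s tau) (b1 s + b0), on which differentiation acts
    linearly on the coefficients ([C_derive_quasipoly]).  At the real point s0,
    the vanishing of Delta, ..., Delta''' is a linear system in
    e^(-s0 tau) alpha1, e^(-s0 tau) (alpha1 s0 + alpha0), a1 and a0.  Its only
    solution is the one listed in the relations, and there the fourth
    derivative equals 2 tau^2, which is nonzero.

    For part (b), put z = tau (s - s0) = x + i y.  Under the relations,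
    tau^2 Delta(s) = D(z) - e^(-z) N(z) with D(z) = z^2 - 4 z + 6 and
    N(z) = 2 z + 6 (N/D is a Pade approximant of e^z, whence the quadruple
    zero at 0).  Two estimates exclude a root z <> 0 with x >= 0.

    - High frequencies.  A root satisfies e^(2x) |D|^2 = |N|^2.  Since
      e^(2x) >= 1 + 2x, this is a polynomial inequality in x and y^2, and it
      fails when x >= 0 and y^2 >= 9 ([normalized_root_frequency_bound]).

    - Low frequencies.  Integrating by parts,
      D(z) - e^(-z) N(z) = z^4 * int_0^1 t (1-t)^2 e^(-z t) dt.
      Once the integrand is multiplied by e^(i y / 2), its real part is
      t (1-t)^2 e^(-x t) cos (y (t - 1/2)), which is positive on (0, 1) when
      |y| < 3 < PI.  Hence the integral does not vanish and z = 0
      ([normalized_root_low_frequency]).  The mean value theorem for an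
      explicit antiderivative replaces the integral. *)

(** * The complex exponential is its own derivative *)

(** The rules for products and compositions concern [C] as a module over itself
    through its absolute value, while [C_derive] refers to [C_NormedModule].
    The two uniform structures differ, but both norms are [Cmod], and
    differentiability depends on the norm alone. *)
Lemma is_derive_C_AbsRing (f : C -> C) (z l : C) :
  @is_derive C_AbsRing (AbsRing_NormedModule C_AbsRing) f z l ->
  @is_derive C_AbsRing C_NormedModule f z l.
Proof.
  intros [[Hp Hs Hn] Hd]. split; [split; assumption |].
  intros x Hx. exact (Hd x Hx).
Qed.

(** Both bounds follow from 1 + x <= e^x and 1 - x <= e^(-x) = 1 / e^x. *)
Lemma exp_remainder (x : R) :
  Rabs x <= 1 / 2 -> exp x <= 2 /\ Rabs (exp x - 1 - x) <= 2 * x ^ 2.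
Proof.
  intros Hx. apply Rabs_le_between in Hx.
  pose proof (exp_ineq1_le x) as Hlo.
  pose proof (exp_ineq1_le (- x)) as Hhi.
  assert (He : exp x * exp (- x) = 1).
  { rewrite <- exp_plus, Rplus_opp_r. apply exp_0. }
  pose proof (exp_pos x) as Hpos.
  assert (Hup : exp x * (1 - x) <= 1) by nra.
  split; [nra |].
  apply Rabs_le_between. split; nra.
Qed.

Lemma Rabs_sin_le (y : R) : Rabs (sin y) <= Rabs y.
Proof.
  destruct (MVT_gen sin 0 y cos) as [c [_ Hc]].
  - intros t _. auto_derive; [trivial | ring].
  - intros t _. apply continuity_sin.
  - rewrite sin_0, !Rminus_0_r in Hc.
    rewrite Hc, Rabs_mult.
    pose proof (Rabs_pos y).
    assert (Rabs (cos c) <= 1) by (apply Rabs_le; apply COS_bound).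
    nra.
Qed.

Lemma cos_remainder (y : R) : 0 <= 1 - cos y <= y ^ 2 / 2.
Proof.
  pose proof (COS_bound y) as [_ Hle].
  pose proof (Rabs_sin_le (y / 2)) as Hs.
  apply Rsqr_le_abs_1 in Hs. unfold Rsqr in Hs.
  replace y with (2 * (y / 2)) at 2 by field.
  rewrite cos_2a_sin. split; [| nra].
  pose proof (SIN_bound (y / 2)). nra.
Qed.

Lemma sin_remainder (y : R) : Rabs y <= 1 / 2 -> Rabs (sin y - y) <= y ^ 2.
Proof.
  intros Hy.
  destruct (MVT_gen (fun t => sin t - t) 0 y (fun t => cos t - 1))
    as [c [Hc Heq]].
  - intros t _. auto_derive; [trivial | ring].
  - intros t _. apply continuity_pt_minus;
      [apply continuity_sin | apply derivable_continuous_pt, derivable_pt_id].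
  - rewrite sin_0 in Heq.
    replace (sin y - y) with ((cos c - 1) * y) by lra.
    assert (Hcy : Rabs c <= Rabs y).
    { revert Hc. unfold Rmin, Rmax, Rabs.
      destruct (Rle_dec 0 y), (Rcase_abs c), (Rcase_abs y); lra. }
    pose proof (cos_remainder c) as [H0 H1].
    rewrite Rabs_mult, <- (Rabs_Ropp (cos c - 1)), Rabs_pos_eq by lra.
    pose proof (Rabs_pos c). pose proof (Rabs_pos y).
    rewrite <- (pow2_abs y). rewrite <- (pow2_abs c) in H1. nra.
Qed.

Lemma Cexp_plus (z w : C) : Cexp (z + w) = (Cexp z * Cexp w)%C.
Proof.
  destruct z as [x y], w as [u v]. unfold Cexp, Cmult. simpl.
  rewrite exp_plus, cos_plus, sin_plus. f_equal; ring.
Qed.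

Lemma Cmod_le_Rabs_plus (z : C) : Cmod z <= Rabs (Re z) + Rabs (Im z).
Proof.
  unfold Cmod. pose proof (Rabs_pos (Re z)). pose proof (Rabs_pos (Im z)).
  rewrite <- (sqrt_pow2 (Rabs (Re z) + Rabs (Im z))) by lra.
  apply sqrt_le_1_alt.
  change (fst z) with (Re z). change (snd z) with (Im z).
  rewrite <- (pow2_abs (Re z)), <- (pow2_abs (Im z)). nra.
Qed.

(** A quadratic remainder at 0 gives differentiability at 0, and the addition
    formula carries it to every point. *)
Lemma Cexp_remainder (h : C) :
  Cmod h <= 1 / 2 -> Cmod (Cexp h - 1 - h) <= 8 * Cmod h ^ 2.
Proof.
  intros Hh.
  pose proof (Rmax_Cmod h) as Hmax.
  destruct h as [x y]. simpl fst in *. simpl snd in *.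
  set (r := Cmod (x, y)) in *.
  assert (Hx : Rabs x <= r) by (eapply Rle_trans; [apply Rmax_l | apply Hmax]).
  assert (Hy : Rabs y <= r) by (eapply Rle_trans; [apply Rmax_r | apply Hmax]).
  clear Hmax.
  destruct (exp_remainder x) as [He Hex]; [lra |].
  pose proof (sin_remainder y ltac:(lra)) as Hs.
  pose proof (cos_remainder y) as Hc.
  pose proof (exp_pos x) as Hpos.
  rewrite <- (pow2_abs x) in Hex. rewrite <- (pow2_abs y) in Hs, Hc.
  pose proof (Rabs_pos x) as Hx0. pose proof (Rabs_pos y) as Hy0.
  assert (Hx2 : Rabs x ^ 2 <= r ^ 2) by nra.
  assert (Hy2 : Rabs y ^ 2 <= r ^ 2) by nra.
  assert (Hxy : Rabs x * Rabs y <= r ^ 2) by nra.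
  assert (Hu : Rabs (exp x * cos y - 1 - x) <= 3 * r ^ 2).
  { replace (exp x * cos y - 1 - x)
      with ((exp x - 1 - x) + - (exp x * (1 - cos y))) by ring.
    eapply Rle_trans; [apply Rabs_triang |].
    rewrite Rabs_Ropp, Rabs_mult, (Rabs_pos_eq (exp x)), (Rabs_pos_eq (1 - _))
      by lra.
    nra. }
  assert (Hv : Rabs (exp x * sin y - y) <= 5 * r ^ 2).
  { replace (exp x * sin y - y)
      with (exp x * (sin y - y) + ((exp x - 1 - x) * y + x * y)) by ring.
    eapply Rle_trans; [apply Rabs_triang |].
    eapply Rle_trans; [apply Rplus_le_compat_l, Rabs_triang |].
    rewrite !Rabs_mult, (Rabs_pos_eq (exp x)) by lra.
    assert (Rabs (exp x - 1 - x) * Rabs y <= r ^ 2).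
    { apply Rle_trans with (2 * Rabs x ^ 2 * Rabs y); nra. }
    nra. }
  replace (Cexp (x, y) - 1 - (x, y))%C
    with (exp x * cos y - 1 - x, exp x * sin y - y).
  2:{ unfold Cexp, Cminus, Cplus, Copp. simpl. f_equal; ring. }
  eapply Rle_trans; [apply Cmod_le_Rabs_plus |].
  simpl. simpl in Hu, Hv. lra.
Qed.

Lemma is_derive_Cexp (z : C) :
  @is_derive C_AbsRing (AbsRing_NormedModule C_AbsRing) Cexp z (Cexp z).
Proof.
  split; [apply is_linear_scal_l |].
  intros w Hw eps. apply (@is_filter_lim_locally_unique C_AbsRing
                           (AbsRing_NormedModule C_AbsRing)) in Hw. subst w.
  set (M := 8 * (Cmod (Cexp z) + 1)).
  assert (HM : 0 < M) by (pose proof (Cmod_ge_0 (Cexp z)); unfold M; lra).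
  assert (Hd : 0 < Rmin (1 / 2) (eps / M)).
  { apply Rmin_pos; [lra |]. apply Rdiv_lt_0_compat; [apply cond_pos | lra]. }
  exists (mkposreal _ Hd). intros w Hw.
  change (Cmod (w - z) < Rmin (1 / 2) (eps / M)) in Hw.
  change (Cmod (Cexp w - Cexp z - (w - z) * Cexp z) <= eps * Cmod (w - z)).
  set (h := (w - z)%C) in *.
  replace w with (z + h)%C by (unfold h; ring).
  rewrite Cexp_plus.
  replace (Cexp z * Cexp h - Cexp z - h * Cexp z)%C
    with (Cexp z * (Cexp h - 1 - h))%C by ring.
  rewrite Cmod_mult.
  pose proof (Rmin_l (1 / 2) (eps / M)). pose proof (Rmin_r (1 / 2) (eps / M)).
  pose proof (Cexp_remainder h ltac:(lra)) as Hr.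
  pose proof (Cmod_ge_0 h) as Hh. pose proof (Cmod_ge_0 (Cexp z)) as Hz.
  assert (HMh : M * Cmod h <= eps).
  { apply Rmult_le_reg_r with (/ M); [apply Rinv_0_lt_compat; lra |].
    replace (M * Cmod h * / M) with (Cmod h) by (field; lra).
    change (Cmod h <= eps / M). lra. }
  apply Rle_trans with (M * Cmod h * Cmod h);
    [| apply Rmult_le_compat_r; assumption].
  apply Rle_trans with (Cmod (Cexp z) * (8 * Cmod h ^ 2));
    [apply Rmult_le_compat_l; assumption |].
  unfold M. pose proof (pow2_ge_0 (Cmod h)). nra.
Qed.

(** * Derivatives of the quasipolynomial and the quadruple root *)

(** The coefficient p2 of s^2 is left free so that the family is closed under
    differentiation. *)
Definition quasipoly (tau p2 p1 p0 b1 b0 : R) (s : C) : C :=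
  (p2 * s ^ 2 + p1 * s + p0 + Cexp (- s * tau) * (b1 * s + b0))%C.

Lemma is_derive_quasipoly (tau p2 p1 p0 b1 b0 : R) (s : C) :
  @is_derive C_AbsRing C_NormedModule (quasipoly tau p2 p1 p0 b1 b0) s
    (quasipoly tau 0 (2 * p2) p1 (- tau * b1) (b1 - tau * b0) s).
Proof.
  apply is_derive_C_AbsRing.
  assert (Haff : forall (a b z : C),
    @is_derive C_AbsRing (AbsRing_NormedModule C_AbsRing)
      (fun w => a * w + b)%C z a).
  { intros a b z.
    evar_last.
    - apply (@is_derive_plus C_AbsRing (AbsRing_NormedModule C_AbsRing)
               (fun w : C => a * w)%C (fun _ => b)).
      + apply (@is_derive_mult C_AbsRing (fun _ => a) (fun w : C => w)).
        * apply (@is_derive_const C_AbsRing (AbsRing_NormedModule C_AbsRing)).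
        * apply (@is_derive_id C_AbsRing).
        * exact Cmult_comm.
      + apply (@is_derive_const C_AbsRing (AbsRing_NormedModule C_AbsRing)).
    - change (0 * z + a * 1 + 0 = a)%C. ring. }
  assert (Hexp : @is_derive C_AbsRing (AbsRing_NormedModule C_AbsRing)
            (fun w : C => Cexp (- w * tau)%C) s
            (- tau * Cexp (- s * tau))%C).
  { apply (@is_derive_comp C_AbsRing (AbsRing_NormedModule C_AbsRing) Cexp
             (fun w : C => (- w * tau)%C)).
    - apply is_derive_Cexp.
    - eapply is_derive_ext; [| apply (Haff (- tau)%C 0%C)].
      intros w. simpl. ring. }
  evar_last.
  - apply (@is_derive_ext C_AbsRing (AbsRing_NormedModule C_AbsRing)
             (fun w : C => (p2 * w + p1) * w + p0
                       + Cexp (- w * tau) * (b1 * w + b0))%C).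
    { intros w. unfold quasipoly. change ((p2 * w + p1) * w + p0
        + Cexp (- w * tau) * (b1 * w + b0) = p2 * w ^ 2 + p1 * w + p0
        + Cexp (- w * tau) * (b1 * w + b0))%C. ring. }
    apply (@is_derive_plus C_AbsRing (AbsRing_NormedModule C_AbsRing)
      (fun w : C => (p2 * w + p1) * w + p0)%C
      (fun w : C => Cexp (- w * tau) * (b1 * w + b0))%C).
    + apply (@is_derive_plus C_AbsRing (AbsRing_NormedModule C_AbsRing)
        (fun w : C => (p2 * w + p1) * w)%C (fun _ => RtoC p0)).
      * apply (@is_derive_mult C_AbsRing (fun w : C => p2 * w + p1)%C
                 (fun w : C => w)).
        -- apply Haff.
        -- apply (@is_derive_id C_AbsRing).
        -- exact Cmult_comm.
      * apply (@is_derive_const C_AbsRing (AbsRing_NormedModule C_AbsRing)).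
    + apply (@is_derive_mult C_AbsRing (fun w : C => Cexp (- w * tau))%C
                 (fun w : C => b1 * w + b0)%C).
      * exact Hexp.
      * apply Haff.
      * exact Cmult_comm.
  - unfold quasipoly. change (p2 * s + (p2 * s + p1) * 1 + 0
      + (- tau * Cexp (- s * tau) * (b1 * s + b0) + Cexp (- s * tau) * b1)
      = 0%R * s ^ 2 + (2 * p2)%R * s + p1
        + Cexp (- s * tau) * ((- tau * b1)%R * s + (b1 - tau * b0)%R))%C.
    rewrite RtoC_minus, !RtoC_mult, RtoC_opp. ring.
Qed.

Lemma C_derive_quasipoly (tau p2 p1 p0 b1 b0 : R) :
  C_derive (quasipoly tau p2 p1 p0 b1 b0)
  = quasipoly tau 0 (2 * p2) p1 (- tau * b1) (b1 - tau * b0).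
Proof.
  apply functional_extensionality. intros s.
  apply is_C_derive_unique, is_derive_quasipoly.
Qed.

Lemma quasipolynomial_quasipoly (tau a0 a1 alpha0 alpha1 : R) :
  quasipolynomial tau a0 a1 alpha0 alpha1 = quasipoly tau 1 a1 a0 alpha1 alpha0.
Proof.
  apply functional_extensionality. intros s.
  unfold quasipolynomial, quasipoly. ring.
Qed.

Lemma quasipoly_RtoC (tau p2 p1 p0 b1 b0 s : R) :
  quasipoly tau p2 p1 p0 b1 b0 s
  = RtoC (p2 * s ^ 2 + p1 * s + p0 + exp (- s * tau) * (b1 * s + b0)).
Proof.
  assert (He : Cexp (- s * tau)%C = RtoC (exp (- s * tau))).
  { rewrite <- RtoC_opp, <- RtoC_mult. unfold Cexp, RtoC. simpl.
    rewrite cos_0, sin_0. f_equal; ring. }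
  unfold quasipoly. rewrite He.
  rewrite !RtoC_plus, !RtoC_mult, RtoC_plus, RtoC_mult, RtoC_pow. ring.
Qed.

(** The third derivative vanishes exactly when the combinations
    A1 = e^(-s0 tau) alpha1 and A0 = e^(-s0 tau) (alpha1 s0 + alpha0) satisfy
    tau A0 = 3 A1; the second derivative then gives tau A1 = -2, the first one
    gives a1 and the value at s0 gives a0. *)
Lemma multiplicity_four_iff_relations (tau a0 a1 alpha0 alpha1 s0 : R) :
  0 < tau ->
  root_of_multiplicity (quasipolynomial tau a0 a1 alpha0 alpha1) (RtoC s0) 4 <->
  quadruple_root_relations tau a0 a1 alpha0 alpha1 s0.
Proof.
  intros Htau.
  assert (Hinv : exp (- s0 * tau) * exp (s0 * tau) = 1).
  { rewrite <- exp_plus, <- exp_0. f_equal. ring. }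
  pose proof (exp_pos (- s0 * tau)) as Hpos.
  rewrite quasipolynomial_quasipoly. unfold root_of_multiplicity.
  split.
  - intros [_ [Hvan _]].
    pose proof (Hvan 0%nat ltac:(lia)) as H0.
    pose proof (Hvan 1%nat ltac:(lia)) as H1.
    pose proof (Hvan 2%nat ltac:(lia)) as H2.
    pose proof (Hvan 3%nat ltac:(lia)) as H3.
    unfold C_derive_n in H0, H1, H2, H3; simpl in H0, H1, H2, H3.
    rewrite quasipoly_RtoC in H0.
    rewrite C_derive_quasipoly, quasipoly_RtoC in H1.
    rewrite !C_derive_quasipoly, quasipoly_RtoC in H2.
    rewrite !C_derive_quasipoly, quasipoly_RtoC in H3.
    apply RtoC_inj in H0, H1, H2, H3.
    set (e := exp (- s0 * tau)) in *. set (e' := exp (s0 * tau)) in *.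
    assert (HA0 : tau * (e * (alpha1 * s0 + alpha0)) = 3 * (e * alpha1)).
    { apply Rmult_eq_reg_l with (- tau ^ 2); [| nra].
      ring_simplify in H3. ring_simplify. lra. }
    assert (HA1 : tau * (e * alpha1) = -2).
    { assert (tau * (tau * (e * (alpha1 * s0 + alpha0)))
              = 3 * (tau * (e * alpha1))) by (rewrite HA0; ring).
      lra. }
    assert (Halpha1 : alpha1 = - (2 / tau) * e').
    { apply Rmult_eq_reg_l with (tau * e); [| nra].
      transitivity (-2 * (e * e')); [rewrite Hinv; lra | field; lra]. }
    assert (Halpha0 : alpha0 = 2 / tau * e' * (s0 - 3 / tau)).
    { apply Rmult_eq_reg_l with (tau ^ 2 * e);
        [| apply Rmult_integral_contrapositive_currified; nra].
      transitivity (2 * (tau * s0 - 3) * (e * e')); [| field; lra].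
      rewrite Hinv.
      transitivity (tau * (tau * (e * (alpha1 * s0 + alpha0)))
                    - tau * s0 * (tau * (e * alpha1))); [ring |].
      rewrite HA0, HA1.
      transitivity (3 * (tau * (e * alpha1)) + 2 * tau * s0); [ring |].
      rewrite HA1. ring. }
    assert (Ha1 : a1 = - (4 / tau) - 2 * s0).
    { apply Rmult_eq_reg_l with tau; [| lra].
      transitivity (- 4 - 2 * tau * s0); [| field; lra].
      assert (tau * a1 = - 2 * tau * s0 - tau * (e * alpha1)
        + tau * (tau * (e * (alpha1 * s0 + alpha0)))).
      { replace a1 with (- (2 * s0) - e * (- tau * alpha1 * s0
          + (alpha1 - tau * alpha0))) by lra. ring. }
      rewrite HA0 in H. lra. }
    repeat split; try assumption.
    assert (HB : e * (alpha1 * s0 + alpha0) = - (6 / tau ^ 2)).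
    { apply Rmult_eq_reg_l with (tau ^ 2); [| nra].
      transitivity (tau * (tau * (e * (alpha1 * s0 + alpha0)))); [ring |].
      rewrite HA0. transitivity (3 * (tau * (e * alpha1))); [ring |].
      rewrite HA1. field. lra. }
    replace a0 with (- (s0 ^ 2) - a1 * s0 - e * (alpha1 * s0 + alpha0)) by lra.
    rewrite HB, Ha1. field. lra.
  - intros (-> & -> & -> & ->).
    set (e' := exp (s0 * tau)) in *.
    split; [| split].
    + intros z. eexists. apply is_derive_quasipoly.
    + intros k Hk.
      destruct k as [| [| [| [| k]]]]; [| | | | lia];
        unfold C_derive_n; simpl Nat.iter;
        rewrite ?C_derive_quasipoly, quasipoly_RtoC; f_equal;
        replace e' with (/ exp (- s0 * tau)) by
          (apply Rmult_eq_reg_l with (exp (- s0 * tau));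
             [rewrite Hinv; field |]; lra);
        field; lra.
    + unfold C_derive_n. simpl Nat.iter.
      rewrite !C_derive_quasipoly, quasipoly_RtoC.
      intros H. apply RtoC_inj in H.
      assert (Hval : 2 * tau ^ 2 = 0).
      { rewrite <- H. replace e' with (/ exp (- s0 * tau)) by
          (apply Rmult_eq_reg_l with (exp (- s0 * tau));
             [rewrite Hinv; field |]; lra).
        field. lra. }
      nra.
Qed.

(** * Roots of the normalized equation *)

(** Real and imaginary parts of z^2 - 4 z + 6 = e^(-z) (2 z + 6) for
    z = x + i y. *)
Definition normalized_root (x y : R) : Prop :=
  x ^ 2 - y ^ 2 - 4 * x + 6
    = exp (- x) * ((2 * x + 6) * cos y + 2 * y * sin y) /\
  2 * x * y - 4 * y
    = exp (- x) * (2 * y * cos y - (2 * x + 6) * sin y).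

(** The constant 9 lies below PI^2, which is what the low-frequency argument
    needs, and is large enough for the crude bound e^(2x) >= 1 + 2x. *)
Lemma normalized_root_frequency_bound (x y : R) :
  0 <= x -> normalized_root x y -> y ^ 2 < 9.
Proof.
  intros Hx [H1 H2].
  set (D := (x ^ 2 - y ^ 2 - 4 * x + 6) ^ 2 + (2 * x * y - 4 * y) ^ 2).
  set (N := (2 * x + 6) ^ 2 + (2 * y) ^ 2).
  assert (HD : D = exp (- x) ^ 2 * N).
  { unfold D, N. rewrite H1, H2.
    transitivity (exp (- x) ^ 2 * (((2 * x + 6) ^ 2 + (2 * y) ^ 2)
      * ((sin y)² + (cos y)²))); [unfold Rsqr; ring |].
    rewrite sin2_cos2. ring. }
  assert (Hexp : (1 + 2 * x) * exp (- x) ^ 2 <= 1).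
  { pose proof (exp_ineq1_le (2 * x)) as He.
    assert (Hinv : exp (2 * x) * exp (- x) ^ 2 = 1).
    { simpl. rewrite Rmult_1_r, <- !exp_plus, <- exp_0. f_equal. ring. }
    rewrite <- Hinv. apply Rmult_le_compat_r; [apply pow2_ge_0 | lra]. }
  assert (HN : 0 <= N) by (unfold N; nra).
  assert (Hle : (1 + 2 * x) * D <= N).
  { rewrite HD. nra. }
  apply Rnot_le_lt. intros HY.
  set (u := y ^ 2 - 9).
  assert (Hu : 0 <= u) by (unfold u; lra).
  (* In u = y^2 - 9, all coefficients of (1 + 2x) D - N are positive for
     x >= 0. *)
  assert (Heq : (1 + 2 * x) * D - N
    = (1 + 2 * x) * u ^ 2
      + ((1 + 2 * x) * (2 * (x - 2) ^ 2 + 14) - 4) * u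
      + (2 * x ^ 5 - 15 * x ^ 4 + 84 * x ^ 3 - 198 * x ^ 2 + 162 * x + 81)).
  { unfold D, N, u. ring. }
  (* 2 x^3 (x - 15/4)^2 absorbs the terms of degrees 5 and 4; the remaining
     cubic has its minimum on x >= 0 near x = 9/5. *)
  assert (Hconst :
    0 < 2 * x ^ 5 - 15 * x ^ 4 + 84 * x ^ 3 - 198 * x ^ 2 + 162 * x + 81).
  { replace (2 * x ^ 5 - 15 * x ^ 4 + 84 * x ^ 3 - 198 * x ^ 2 + 162 * x + 81)
      with (2 * x * (x * (x - 15 / 4)) ^ 2
            + x * (447 / 8 * x ^ 2 - 198 * x + 162) + 81) by field.
    assert (0 <= x * (x * (x - 15 / 4)) ^ 2)
      by (apply Rmult_le_pos; [assumption | apply pow2_ge_0]).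
    assert (0 <= x * (x - 9 / 5) ^ 2)
      by (apply Rmult_le_pos; [assumption | apply pow2_ge_0]).
    assert (0 < x * (447 / 8 * x ^ 2 - 198 * x + 162) + 81); [| lra].
    destruct (Rle_lt_dec x 4); [nra |].
    assert (0 < 447 / 8 * x ^ 2 - 198 * x + 162) by nra. nra. }
  assert (0 <= (1 + 2 * x) * u ^ 2) by (pose proof (pow2_ge_0 u); nra).
  assert (0 <= ((1 + 2 * x) * (2 * (x - 2) ^ 2 + 14) - 4) * u).
  { apply Rmult_le_pos; [| assumption]. pose proof (pow2_ge_0 (x - 2)). nra. }
  lra.
Qed.

(** With q(t) = t (1-t)^2 let
    P(t) = q z^3 + q' z^2 + q'' z + q''', so that
    d/dt (e^(-z t) P(t)) = - z^4 q(t) e^(-z t), because q'''' = 0.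
    The polynomial q is the one for which P(0) = z^2 - 4 z + 6 and
    P(1) = 2 z + 6, so e^(-z t) P(t) takes equal values at 0 and 1 when z is a
    root.  Multiplying by conj(z)^4 makes the factor z^4 positive, and the
    rotation e^(i y / 2) centres the phase of e^(-i y t) on [0, 1], so that its
    cosine stays positive for all |y| < PI, including y = 0. *)
Lemma normalized_root_low_frequency (x y : R) :
  normalized_root x y -> y ^ 2 < 9 -> x = 0 /\ y = 0.
Proof.
  intros [H1 H2] Hy.
  assert (Hm0 : 0 <= x ^ 2 + y ^ 2) by nra.
  destruct (Rle_lt_or_eq_dec _ _ Hm0) as [Hm | Hm]; [exfalso | nra].
  set (m := x ^ 2 + y ^ 2) in *.
  set (q := fun t : R => t * (1 - t) ^ 2).
  (* a - i b is conj(z)^4 P(t), and K is the real part of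
     conj(z)^4 e^(i y / 2) e^(-z t) P(t). *)
  set (a := fun t : R => m ^ 3 * q t * x
    + m ^ 2 * (1 - 4 * t + 3 * t ^ 2) * (x ^ 2 - y ^ 2)
    + m * (6 * t - 4) * (x ^ 3 - 3 * x * y ^ 2)
    + 6 * (x ^ 4 - 6 * x ^ 2 * y ^ 2 + y ^ 4)).
  set (b := fun t : R => m ^ 3 * q t * y
    + m ^ 2 * (1 - 4 * t + 3 * t ^ 2) * (2 * x * y)
    + m * (6 * t - 4) * (3 * x ^ 2 * y - y ^ 3)
    + 6 * (4 * x ^ 3 * y - 4 * x * y ^ 3)).
  set (K := fun t : R => exp (- x * t)
    * (a t * cos (y * (t - 1 / 2)) - b t * sin (y * (t - 1 / 2)))).
  assert (HK' : forall t, is_derive K t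
    (- (m ^ 4 * q t * exp (- x * t) * cos (y * (t - 1 / 2))))).
  { intros t. unfold K, a, b, q. auto_derive; [trivial |].
    change (t + - (1 / 2)) with (t - 1 / 2). unfold m. ring. }
  (* conj(z)^4 = w1 - i w2 below; the rotation by y / 2 turns e^(-i y) into
     the conjugate of the phase at 0. *)
  assert (HK : K 0 = K 1).
  { unfold K, a, b, q.
    replace (- x * 0) with 0 by ring. replace (- x * 1) with (- x) by ring.
    replace (y * (0 - 1 / 2)) with (- (y / 2)) by field.
    replace (y * (1 - 1 / 2)) with (y / 2) by field.
    rewrite exp_0, cos_neg, sin_neg.
    set (w1 := x ^ 4 - 6 * x ^ 2 * y ^ 2 + y ^ 4).
    set (w2 := 4 * x ^ 3 * y - 4 * x * y ^ 3).
    transitivity ((w1 * cos (y / 2) + w2 * sin (y / 2))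
                    * (x ^ 2 - y ^ 2 - 4 * x + 6)
                  + (w2 * cos (y / 2) - w1 * sin (y / 2))
                    * (2 * x * y - 4 * y)).
    { unfold w1, w2, m. ring. }
    rewrite H1, H2.
    transitivity (exp (- x)
      * ((w1 * (2 * x + 6) + w2 * (2 * y)) * cos (y - y / 2)
         + (w1 * (2 * y) - w2 * (2 * x + 6)) * sin (y - y / 2))).
    { rewrite cos_minus, sin_minus. ring. }
    replace (y - y / 2) with (y / 2) by field.
    unfold w1, w2, m. ring. }
  destruct (MVT_cor2 K (fun t => - (m ^ 4 * q t * exp (- x * t)
              * cos (y * (t - 1 / 2)))) 0 1) as [t [Ht Ht01]]; [lra | |].
  { intros t _. apply is_derive_Reals, HK'. }
  assert (Hcos : 0 < cos (y * (t - 1 / 2))).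
  { pose proof PI2_3_2.
    assert (Hy3 : -3 < y < 3) by (split; nra).
    apply cos_gt_0; nra. }
  assert (Hq : 0 < q t).
  { unfold q. apply Rmult_lt_0_compat; [lra |]. apply pow_lt. lra. }
  pose proof (exp_pos (- x * t)) as He.
  assert (0 < m ^ 4 * q t * exp (- x * t) * cos (y * (t - 1 / 2))).
  { assert (0 < m ^ 4) by apply pow_lt, Hm.
    auto using Rmult_lt_0_compat. }
  lra.
Qed.

(** * Strict dominance *)

Lemma normalized_root_of_root (tau a0 a1 alpha0 alpha1 s0 : R) (s : C) :
  0 < tau ->
  quadruple_root_relations tau a0 a1 alpha0 alpha1 s0 ->
  quasipolynomial tau a0 a1 alpha0 alpha1 s = RtoC 0 ->
  normalized_root (tau * (Re s - s0)) (tau * Im s).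
Proof.
  intros Htau (-> & -> & -> & ->) Hs.
  destruct s as [p r]. simpl.
  pose proof (f_equal Re Hs) as HR. pose proof (f_equal Im Hs) as HI.
  clear Hs. unfold quasipolynomial, Cexp in HR, HI. simpl in HR, HI.
  replace (- p * tau - - r * 0) with (- (p * tau)) in HR, HI by ring.
  replace (- p * 0 + - r * tau) with (- (tau * r)) in HR, HI by ring.
  rewrite cos_neg, sin_neg in HR, HI.
  assert (He : exp (- (tau * (p - s0))) = exp (- (p * tau)) * exp (s0 * tau)).
  { rewrite <- exp_plus. f_equal. ring. }
  unfold normalized_root. rewrite He.
  set (e := exp (- (p * tau))) in *. set (e' := exp (s0 * tau)) in *.
  split; apply Rminus_diag_uniq.
  - rewrite <- (Rmult_0_r (tau ^ 2)), <- HR. field. lra.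
  - rewrite <- (Rmult_0_r (tau ^ 2)), <- HI. field. lra.
Qed.

Lemma roots_left_of_quadruple_root (tau a0 a1 alpha0 alpha1 s0 : R) :
  0 < tau ->
  quadruple_root_relations tau a0 a1 alpha0 alpha1 s0 ->
  forall s : C, s <> RtoC s0 ->
    quasipolynomial tau a0 a1 alpha0 alpha1 s = RtoC 0 -> Re s < s0.
Proof.
  intros Htau Hrel s Hne Hs.
  pose proof (normalized_root_of_root _ _ _ _ _ _ _ Htau Hrel Hs) as Hroot.
  apply Rnot_le_lt. intros Hle. apply Hne.
  assert (Hx : 0 <= tau * (Re s - s0)) by (apply Rmult_le_pos; lra).
  pose proof (normalized_root_frequency_bound _ _ Hx Hroot) as Hy.
  destruct (normalized_root_low_frequency _ _ Hroot Hy) as [Hx0 Hy0].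
  destruct s as [p r]. simpl in *. unfold RtoC. f_equal; nra.
Qed.

Theorem theorem3 (tau a0 a1 alpha0 alpha1 s0 : R) (Htau : 0 < tau) :
  (root_of_multiplicity (quasipolynomial tau a0 a1 alpha0 alpha1) (RtoC s0) 4 <->
   quadruple_root_relations tau a0 a1 alpha0 alpha1 s0) /\
  (quadruple_root_relations tau a0 a1 alpha0 alpha1 s0 ->
   strictly_dominant_root (quasipolynomial tau a0 a1 alpha0 alpha1) (RtoC s0)).
Proof.
  split; [apply multiplicity_four_iff_relations, Htau |].
  intros Hrel. split.
  - apply (multiplicity_four_iff_relations _ _ _ _ _ _ Htau) in Hrel.
    destruct Hrel as [_ [Hvan _]]. exact (Hvan 0%nat ltac:(lia)).
  - apply roots_left_of_quadruple_root; assumption.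
Qed.
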